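(* Let $M\ge0$. Let $c_0$ be the linear functional associated to the measure $e^{-x}dx+M\delta(0)$ and $c_1$ the one associated to $e^{-x}dx$, on $]0,+\infty[$. For every $n\ge1$, $$c_1((p')^2)\le\frac1{\mu_{1,n}}\,c_0(p^2)\qquad\text{for all }p\in\mathcal P_n,$$ where $\mu_{1,n}$ is the smallest zero of the polynomial $A_n(\lambda)$ satisfying the three term recurrence relation $$A_n(\lambda)=(\lambda-2)A_{n-1}(\lambda)-A_{n-2}(\lambda),\quad n\ge2,$$ with $A_0(\lambda)=1$ and $A_1(\lambda)=\lambda-\frac{1+2M}{1+M}$.
   Context: $\mathcal P_n$ is the space of real polynomials in one variable of degree at most $n$. $\delta(0)$ is the Dirac measure at $0$, so $c_0(p)=\int_0^\infty p(x)e^{-x}dx+Mp(0)$ and $c_1(p)=\int_0^\infty p(x)e^{-x}dx$. The zeros of $A_n$ are real and positive. *)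

(* Defs.v *)
From HB Require Import structures.
From mathcomp Require Import all_boot all_order all_algebra.
From mathcomp Require Import all_classical all_reals all_analysis.

Set Implicit Arguments.
Unset Strict Implicit.
Unset Printing Implicit Defensive.

Import Order.TTheory GRing.Theory Num.Theory.
Local Open Scope classical_set_scope.
Local Open Scope ring_scope.

(* The functionals of e^{-x} dx and of e^{-x} dx + M delta(0) on ]0, +oo[, where
   by convention the mass at the endpoint 0 contributes M p(0). *)
Definition c1 (R : realType) (p : {poly R}) : R :=
  \int[@lebesgue_measure R]_(x in `]0, +oo[) (p.[x] * expR (- x)).

Definition c0 (R : realType) (M : R) (p : {poly R}) : R :=
  c1 p + M * p.[0].

Fixpoint A (R : realType) (M : R) (n : nat) : {poly R} :=
  match n with
  | 0 => 1
  | n1.+1 =>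
    match n1 with
    | 0 => 'X - ((1 + 2 * M) / (1 + M))%:P
    | n2.+1 => ('X - 2%:P) * A M n1 - A M n2
    end
  end.

Definition smallest_zero (R : realType) (q : {poly R}) (mu : R) : Prop :=
  root q mu /\ forall x : R, root q x -> mu <= x.

(* Main.v *)
(* Let [L_k] be the Laguerre polynomials, orthonormal for [e^{-x} dx].  Since
   [L_j = (L_j - L_{j+1})'], writing [p' = \sum_{j<n} c_j L_j] with [c_n = 0]
   gives [p = (p(0) + c_0) L_0 + \sum_{j<n} (c_{j+1} - c_j) L_{j+1}].  By
   Parseval, and after minimizing over [p(0)], the claim becomes
     [M/(1+M) c_0^2 + \sum_{j<n} (c_{j+1} - c_j)^2 >= mu \sum_{j<n} c_j^2].
   The left side is a Jacobi form with characteristic polynomial [A_n], and the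
   LDL^T pivots of the difference of both sides are the ratios of consecutive
   values [(-1)^k A_k(mu)].  Because the smallest zeros of the [A_k] decrease
   with [k], at the smallest zero of [A_n] these values are positive for [k < n]
   and vanish for [k = n]. *)
Require Import Defs.
From mathcomp Require Import all_boot all_order all_algebra.
From mathcomp Require Import all_classical all_reals all_analysis.
From mathcomp Require Import measurable_realfun ring lra.

Import Order.TTheory GRing.Theory Num.Theory numFieldNormedType.Exports.
Local Open Scope classical_set_scope.
Local Open Scope ring_scope.

Set Implicit Arguments.
Unset Strict Implicit.
Unset Printing Implicit Defensive.

(** * Moments of e^{-x} and integration by parts for [c1] *)

Lemma cvg_pow_expRN (R : realType) (k : nat) :
  (x : R) ^+ k * expR (- x) @[x --> +oo] --> (0 : R).
Proof.
(* The term x^{k+1}/(k+1)! of the exponential series gives x^k e^{-x} <= (k+1)!/x for x > 0. *)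
have cvgV : (k.+1)`!%:R * (x : R)^-1 @[x --> +oo] --> (0 : R).
  rewrite -[X in _ --> X](mulr0 (k.+1)`!%:R); apply: cvgMl_tmp.
  apply/gtr0_cvgV0; last exact: cvg_id.
  by near=> x; near: x; exact: nbhs_pinfty_gt.
apply: (squeeze_cvgr _ (cvg_cst 0) cvgV); near=> x.
have x_gt0 : 0 < x by near: x; apply: nbhs_pinfty_gt; exact: num_real.
rewrite mulr_ge0 ?exprn_ge0 ?expR_ge0 ?(ltW x_gt0)//=.
rewrite expRN ler_pdivrMr ?expR_gt0// mulrAC ler_pdivlMr// -exprSr.
rewrite -ler_pdivrMl ?ltr0n ?fact_gt0// mulrC.
by apply: le_trans (expR_ge1Dxn k (ltW x_gt0)); rewrite lerDr.
Unshelve. all: by end_near. Qed.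

(** Since (s e^{-x})' = (s' - s) e^{-x}, the function -s e^{-x} is an antiderivative of x^k e^{-x},
    and s(0) will be the integral. *)
Lemma pow_expRN_antiderivative (R : realType) (k : nat) :
  exists s : {poly R}, [/\ s - s^`() = 'X^k, s.[0] = k`!%:R &
    s.[x : R] * expR (- x) @[x --> +oo] --> (0 : R)].
Proof.
elim: k => [|k [s [ds s0 slim]]].
  exists 1; split; rewrite ?hornerC ?fact0 ?derivC ?subr0//.
  under eq_cvg => x do rewrite hornerC -(expr0 x).
  exact: (@cvg_pow_expRN R 0).
exists ('X^(k.+1) + k.+1%:R *: s); split.
- by rewrite derivD derivZ derivXn /= -ds !scaler_nat; ring.
- by rewrite !hornerE s0 expr0n /= add0r factS natrM.
- have -> : (fun x => ('X^(k.+1) + k.+1%:R *: s).[x] * expR (- x)) =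
      (fun x => x ^+ k.+1 * expR (- x) + k.+1%:R * (s.[x] * expR (- x))).
    by apply/funext => x; rewrite hornerD hornerZ hornerXn mulrDl mulrA.
  have := cvgD (@cvg_pow_expRN R k.+1) (cvgMl_tmp (a := k.+1%:R) slim).
  by rewrite mulr0 addr0 => h; exact: h.
Qed.

Lemma continuous_horner_expRN (R : realType) (p : {poly R}) :
  continuous (fun x => p.[x] * expR (- x)).
Proof.
move=> x; apply: cvgM; first exact: continuous_horner.
apply: continuous_comp; first exact: opp_continuous.
exact: continuous_expR.
Qed.

Lemma integral_pow_expRN (R : realType) (k : nat) :
  (\int[@lebesgue_measure R]_(x in `]0%R, +oo[) ('X^k.[x] * expR (- x))%:E
   = k`!%:R%:E)%E.
Proof.
have [s [ds s0 slim]] := pow_expRN_antiderivative R k.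
have dF (x : R) : is_derive x (1 : R) (fun x => - (s.[x] * expR (- x)))
    ('X^k.[x] * expR (- x)).
  apply: trigger_derive.
  by rewrite -ds hornerD hornerN /GRing.scale /=; ring.
rewrite integral_itv_obnd_cbnd; last first.
  apply/measurable_EFinP.
  apply: measurable_funTS; apply: continuous_measurable_fun.
  exact: continuous_horner_expRN.
rewrite (@ge0_continuous_FTC2y _ _ (fun x => - (s.[x] * expR (- x))) _ 0).
- by rewrite oppr0 expR0 mulr1 s0 EFinN oppeK add0e.
- by move=> x x0; rewrite hornerXn mulr_ge0 ?exprn_ge0 ?expR_ge0.
- exact/continuous_subspaceT/continuous_horner_expRN.
- by rewrite -[X in _ --> X]oppr0; exact: cvgN.
- by move=> x _; exact: ex_derive.
- by apply: cvg_at_right_filter; apply: cvgN; exact: continuous_horner_expRN.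
- by move=> x _; rewrite derive1E derive_val.
Qed.

Lemma integrable_horner_expRN (R : realType) (p : {poly R}) :
  (@lebesgue_measure R).-integrable `]0, +oo[
    (EFin \o (fun x => p.[x] * expR (- x))).
Proof.
rewrite -[p]coefK poly_def.
elim/big_ind: _ => [|q r iq ir|k _].
- apply: eq_integrable (integrable0 _ _) => //= x _.
  by rewrite horner0 mul0r.
- apply: eq_integrable (integrableD _ iq ir) => //= x _.
  by rewrite hornerD mulrDl.
- have iX : (@lebesgue_measure R).-integrable `]0, +oo[
      (EFin \o (fun x => 'X^k.[x] * expR (- x))).
    apply/integrableP; split.
      apply/measurable_EFinP; apply: measurable_funTS.
      apply: continuous_measurable_fun.
      exact: continuous_horner_expRN.
    under eq_integral => x.
      rewrite inE/= in_itv/= andbT => x0.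
      rewrite ger0_norm; last first.
        by rewrite hornerXn mulr_ge0 ?exprn_ge0 ?expR_ge0 ?ltW.
      over.
    by rewrite integral_pow_expRN ltry.
  apply: eq_integrable (integrableZl _ p`_k iX) => //= x _.
  by rewrite hornerZ -mulrA EFinM.
Qed.

Lemma c1D (R : realType) (p q : {poly R}) : c1 (p + q) = c1 p + c1 q.
Proof.
rewrite /c1 -RintegralD//; [|exact: integrable_horner_expRN..].
by apply: eq_Rintegral => x _; rewrite hornerD mulrDl.
Qed.

Lemma c1Z (R : realType) (a : R) (p : {poly R}) : c1 (a *: p) = a * c1 p.
Proof.
rewrite /c1 -RintegralZl//; last exact: integrable_horner_expRN.
by apply: eq_Rintegral => x _; rewrite hornerZ mulrA.
Qed.

Lemma c1Xn (R : realType) (k : nat) : c1 ('X^k : {poly R}) = k`!%:R.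
Proof. by rewrite /c1 /Rintegral integral_pow_expRN. Qed.

(** By linearity it suffices to treat monomials, where this is (k+1)! = (k+1) k!. *)
Lemma c1_by_parts (R : realType) (p : {poly R}) : c1 p = p.[0] + c1 p^`().
Proof.
rewrite -[p]coefK poly_def.
elim/big_ind: _ => [|q r iq ir|k _].
- by rewrite deriv0 horner0 add0r.
- by rewrite derivD hornerD !c1D iq ir addrACA.
- rewrite derivZ !c1Z hornerZ -mulrDr derivXn -scaler_nat c1Z !c1Xn.
  rewrite hornerXn expr0n; case: (k : nat) => [|m] /=.
    by rewrite mul0r addr0 fact0.
  by rewrite add0r factS natrM.
Qed.

(** * Primitives and expansions in Laguerre polynomials *)

Lemma deriv_horner_inj (R : numDomainType) (p q : {poly R}) :
  p^`() = q^`() -> p.[0] = q.[0] -> p = q.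
Proof.
move=> dpq pq0; apply/polyP => -[|i]; first by rewrite -!horner_coef0.
have := congr1 (fun r : {poly R} => r`_i) dpq.
rewrite !coef_deriv => /eqP.
by rewrite -subr_eq0 -mulrnBl mulrn_eq0 /= subr_eq0 => /eqP.
Qed.

Lemma size_deriv_leq (R : nzRingType) (p : {poly R}) (m : nat) :
  (size p <= m.+1)%N -> (size p^`() <= m)%N.
Proof.
have [->|p0 sp] := eqVneq p 0; first by rewrite deriv0 size_poly0.
by rewrite -ltnS; apply: leq_trans sp; apply: lt_size_deriv.
Qed.

Definition primitive (R : fieldType) (p : {poly R}) : {poly R} :=
  \poly_(i < (size p).+1) (if i is j.+1 then p`_j / i%:R else 0).

Lemma primitive0 (R : fieldType) (p : {poly R}) : (primitive p).[0] = 0.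
Proof. by rewrite horner_coef0 coef_poly. Qed.

Lemma deriv_primitive (R : numFieldType) (p : {poly R}) :
  (primitive p)^`() = p.
Proof.
apply/polyP => i; rewrite coef_deriv coef_poly ltnS.
case: ltnP => [_|pi] /=; last by rewrite mul0rn nth_default.
by rewrite -[LHS]mulr_natr divfK// pnatr_eq0.
Qed.

(** The classical Laguerre polynomials, normalized by L_k(0) = 1 and generated by L_{k+1}' = L_k' -
    L_k. *)
Fixpoint laguerre (R : fieldType) (k : nat) : {poly R} :=
  if k is j.+1 then laguerre R j - primitive (laguerre R j) else 1.

Lemma laguerre_at0 (R : fieldType) (k : nat) : (laguerre R k).[0] = 1.
Proof.
by elim: k => [|k ih]; rewrite /= ?hornerC// hornerD hornerN primitive0 subr0.
Qed.

Lemma laguerre_primitive (R : fieldType) (k : nat) :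
  primitive (laguerre R k) = laguerre R k - laguerre R k.+1.
Proof. by rewrite opprB addrC subrK. Qed.

Lemma laguerre_antiderivative (R : numFieldType) (p : {poly R}) (m : nat)
    (c : nat -> R) :
  c m = 0 -> p^`() = \sum_(j < m) c j *: laguerre R j ->
  p = (p.[0] + c 0%N) *: laguerre R 0
    + \sum_(j < m) (c j.+1 - c j) *: laguerre R j.+1.
Proof.
move=> cm dp.
(* Index shift for the summation by parts; the extra term j = m drops out because [c m = 0]. *)
have tel : \sum_(j < m) c j.+1 *: laguerre R j.+1 + c 0%N *: laguerre R 0 =
    \sum_(j < m) c j *: laguerre R j.
  rewrite addrC -(big_ord_recl m (fun j => c j *: laguerre R j)).
  by rewrite big_ord_recr /= cm scale0r addr0.
transitivity (p.[0]%:P +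
    \sum_(j < m) c j *: (laguerre R j - laguerre R j.+1)).
  apply: deriv_horner_inj.
    rewrite derivD derivC add0r dp raddf_sum; apply: eq_bigr => j _.
    by rewrite /= derivZ -laguerre_primitive deriv_primitive.
  rewrite hornerD hornerC horner_sum big1 ?addr0// => j _.
  by rewrite hornerZ hornerD hornerN !laguerre_at0 subrr mulr0.
under eq_bigr do rewrite scalerBr.
under [in RHS]eq_bigr do rewrite scalerBl.
rewrite !sumrB -tel scalerDl.
have -> : p.[0]%:P = p.[0] *: laguerre R 0 by rewrite alg_polyC.
by ring.
Qed.

Lemma laguerre_span (R : numFieldType) (p : {poly R}) (m : nat) :
  (size p <= m)%N ->
  exists2 c : nat -> R, c m = 0 & p = \sum_(j < m) c j *: laguerre R j.
Proof.
elim: m p => [|m ih] p sp.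
  exists (fun=> 0) => //; rewrite big_ord0.
  by apply/eqP; rewrite -size_poly_eq0 -leqn0.
have [c cm dp] := ih p^`() (size_deriv_leq sp).
(* Coefficients of p obtained from those of p'; the first branch only enforces the final zero. *)
pose d j := if j == m.+1 then 0 else
  if j is i.+1 then c i.+1 - c i else p.[0] + c 0%N.
exists d; first by rewrite /d eqxx.
rewrite big_ord_recl [LHS](laguerre_antiderivative cm dp); congr (_ + _).
by apply: eq_bigr => j _; rewrite /d /= eqSS ltn_eqF.
Qed.

(** * Orthonormality from linearity and integration by parts alone *)

Section functional.
Variables (R : realFieldType) (c : {poly R} -> R).
Hypothesis cD : forall p q, c (p + q) = c p + c q.
Hypothesis cZ : forall a p, c (a *: p) = a * c p.
Hypothesis c_by_parts : forall p, c p = p.[0] + c p^`().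

Local Notation L := (laguerre R).

Lemma functional0 : c 0 = 0.
Proof. by rewrite -(scale0r 0) cZ mul0r. Qed.

Lemma functionalB p q : c (p - q) = c p - c q.
Proof. by rewrite cD -scaleN1r cZ mulN1r. Qed.

Lemma functional_sum n (F : 'I_n -> {poly R}) :
  c (\sum_(i < n) F i) = \sum_(i < n) c (F i).
Proof. exact: (big_morph c cD functional0). Qed.

(* Integrate by parts the product of the antiderivatives [L_j - L_{j+1}] and
   [L_k - L_{k+1}], which both vanish at 0. *)
Lemma laguerre_shift j k : c (L j.+1 * L k.+1) = c (L j * L k).
Proof.
have := c_by_parts (primitive (L j) * primitive (L k)).
rewrite hornerM !primitive0 mul0r add0r derivM !deriv_primitive.
rewrite !laguerre_primitive.
move: (L j.+1) (L k.+1) (L j) (L k) => a' b' a b.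
by rewrite !(mulrBl, mulrBr) !(functionalB, cD) => h; lra.
Qed.

(** The shift lowers both indices until one is 0. As L_m is the derivative of L_m - L_{m+1}, which
    vanishes at 0, [c] kills every L_{m+1}. *)
Lemma laguerre_orthonormal j k : c (L j * L k) = (j == k)%:R.
Proof.
have c0 m : c (L m) = (m == 0%N)%:R.
  case: m => [|m]; first by rewrite c_by_parts hornerC derivC functional0 addr0.
  have := c_by_parts (primitive (L m)).
  rewrite primitive0 add0r deriv_primitive laguerre_primitive functionalB.
  move: (L m.+1) (L m) => a b.
  by rewrite /= => /eqP; rewrite -subr_eq0 addrC addKr oppr_eq0 => /eqP.
elim: j k => [|j ih] [|k]; rewrite ?eqSS -?ih ?laguerre_shift//.
- by rewrite mulr1 c0.
- by rewrite mul1r c0 eq_sym.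
- by rewrite mulr1 c0.
Qed.

Lemma laguerre_parseval m (a : nat -> R) :
  c ((\sum_(j < m) a j *: L j) ^+ 2) = \sum_(j < m) a j ^+ 2.
Proof.
rewrite expr2 mulr_suml functional_sum; apply: eq_bigr => j _.
rewrite mulr_sumr functional_sum.
rewrite (bigD1 j)//= big1 ?addr0 => [|k kj].
  by rewrite -scalerAl cZ -scalerAr cZ laguerre_orthonormal eqxx mulr1 expr2.
rewrite -scalerAl cZ -scalerAr cZ laguerre_orthonormal.
by rewrite [_ == _]eq_sym (negbTE kj : (k == j :> nat) = false) !mulr0.
Qed.

End functional.

(** * Smallest zeros of the polynomials [A M k] *)

Lemma exists_smallest_root (R : realFieldType) (q : {poly R}) (a : R) :
  q != 0 -> root q a ->
  exists2 mu, root q mu & forall x, root q x -> mu <= x.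
Proof.
have [n] := ubnP (size q); elim: n q a => // n ih q a; rewrite ltnS => sq q0.
(* Split off X - a; the cofactor of lower degree has a smallest root or no root at all. *)
move=> /factor_theorem[r qr].
have r0 : r != 0 by apply: contraNneq q0 => r0; rewrite qr r0 mul0r.
have rq x : root q x = root r x || (x == a).
  by rewrite qr rootM root_XsubC.
have sr : (size r < n)%N.
  by move: sq; rewrite qr size_Mmonic ?monicXsubC// size_XsubC addn2.
have [[b rb]|nr] := pselect (exists b, root r b).
- have [m rm mle] := ih r b sr r0 rb.
  exists (Num.min a m).
    by rewrite rq; case: leP => _; rewrite ?rm ?eqxx ?orbT.
  by move=> x; rewrite rq ge_min => /orP[/mle->|/eqP->]; rewrite ?orbT ?lexx.
- exists a; first by rewrite rq eqxx orbT.
  move=> x; rewrite rq => /orP[rx|/eqP->//].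
  by case: nr; exists x.
Qed.

Section sturm.
Variables (R : realType) (M : R).

(** The sign turns the monic det(x - J) into det(J - x), with J the k by k Jacobi matrix. *)
Definition signedA k (x : R) : R := (-1) ^+ k * (A M k).[x].

Local Notation B := signedA.

Lemma signedA0 x : B 0 x = 1.
Proof. by rewrite /signedA/= hornerC mulr1. Qed.

Lemma signedA1 x : B 1 x = (1 + 2 * M) / (1 + M) - x.
Proof. by rewrite /signedA expr1 [A M 1]/= hornerXsubC mulN1r opprB. Qed.

Lemma signedASS k x : B k.+2 x = (2 - x) * B k.+1 x - B k x.
Proof.
rewrite /signedA.
have -> : A M k.+2 = ('X - 2%:P) * A M k.+1 - A M k by [].
by rewrite hornerD hornerN hornerM hornerXsubC !exprS; ring.
Qed.

Lemma root_signedA k x : root (A M k) x = (B k x == 0).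
Proof. by rewrite /root /signedA mulf_eq0 signr_eq0. Qed.

Lemma signedA_ge1 (M_ge0 : 0 <= M) k (x : R) : x <= 0 -> 1 <= B k x.
Proof.
move=> x0.
(* Monotonicity in k carries the induction: B_{k+2} - B_{k+1} = (B_{k+1} - B_k) - x B_{k+1}. *)
suff : 1 <= B k x /\ B k x <= B k.+1 x by case.
elim: k => [|k [h1 h2]].
  rewrite signedA0 signedA1; split=> //.
  have : 1 <= (1 + 2 * M) / (1 + M).
    by rewrite ler_pdivlMr; lra.
  by lra.
split; first exact: le_trans h1 h2.
have : 0 <= - x * B k.+1 x by rewrite mulr_ge0 ?oppr_ge0//; lra.
by rewrite signedASS; lra.
Qed.

Lemma exists_smallest_zeroA (M_ge0 : 0 <= M) k :
  exists mu, [/\ smallest_zero (A M k.+1) mu, 0 < mu &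
    forall j x, (j <= k)%N -> x <= mu -> 0 < B j x].
Proof.
have ivt m (b : R) : 0 <= b -> B m b <= 0 ->
    exists2 x, 0 <= x <= b & root (A M m) x.
  move=> b0 Bb.
  (* [poly_ivt] expects a sign change from negative to positive, hence -B_m. *)
  have hq x : ((-1) ^+ m.+1 *: A M m).[x] = - B m x.
    by rewrite hornerZ exprS mulN1r mulNr.
  have [|x xb rx] := @poly_ivt R ((-1) ^+ m.+1 *: A M m) _ _ b0.
    rewrite !hq oppr_ge0 Bb oppr_le0 andbT.
    by apply: le_trans (signedA_ge1 M_ge0 m (lexx 0)).
  by exists x => //; move: rx; rewrite root_signedA /root hq oppr_eq0.
elim: k => [|k [mu [[rmu mule] mu0 Bpos]]].
  have r1 x : root (A M 1) x = (x == (1 + 2 * M) / (1 + M)).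
    by rewrite root_signedA signedA1 subr_eq0 eq_sym.
  exists ((1 + 2 * M) / (1 + M)); split.
  - by split=> [|x]; rewrite r1// => /eqP->.
  - by apply: divr_gt0; lra.
  - by case=> // x _ _; rewrite signedA0.
(* At the smallest zero of A_{k+1} the recurrence leaves B_{k+2} = -B_k < 0, while B_{k+2}(0) >= 1;
   so A_{k+2} has a smaller zero. *)
have Bmu : B k.+2 mu < 0.
  move: rmu; rewrite root_signedA signedASS => /eqP->.
  by rewrite mulr0 sub0r oppr_lt0 Bpos.
have [a /andP[a0 amu] ra] := ivt k.+2 mu (ltW mu0) (ltW Bmu).
have A0 : A M k.+2 != 0.
  apply: contraTneq (signedA_ge1 M_ge0 k.+2 (lexx 0)) => A0.
  by rewrite /signedA A0 horner0 mulr0 ler10.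
have [m rm mle] := exists_smallest_root A0 ra.
have m0 : 0 < m.
  rewrite ltNge; apply: contraTN rm => /(signedA_ge1 M_ge0 k.+2) h.
  by rewrite root_signedA gt_eqF// (lt_le_trans ltr01).
have mmu : m < mu.
  rewrite lt_neqAle (le_trans (mle _ ra) amu) andbT.
  by apply: contraTneq rm => ->; rewrite root_signedA lt_eqF.
exists m; split=> // j x; rewrite leq_eqVlt => /orP[/eqP->|jk] xm; last first.
  by apply: Bpos => //; apply: le_trans xm (ltW mmu).
(* Case j = k+1: a nonpositive value would give A_{k+1} a zero below its smallest zero [mu]. *)
rewrite ltNge; apply/negP => Bx.
have [x0|x0] := leP 0 x; last first.
  by have := signedA_ge1 M_ge0 k.+1 (ltW x0); rewrite leNgt (le_lt_trans Bx).
have [y /andP[_ yx] ry] := ivt _ _ x0 Bx.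
have := le_lt_trans (le_trans (le_trans (mule _ ry) yx) xm) mmu.
by rewrite ltxx.
Qed.

(** * Lower bound for the Jacobi form *)

(** Completing squares in c_0, ..., c_{m-1} leaves the last pivot times c_m^2. The separate c_m^2
    stands for (c_{m+1} - c_m)^2 with c_{m+1} = 0. *)
Lemma jacobi_form_ge (M_ge0 : 0 <= M) (c : nat -> R) (mu : R) m :
  (forall j, (j <= m)%N -> 0 < B j mu) ->
  B m.+1 mu / B m mu * c m ^+ 2 <=
  M / (1 + M) * c 0%N ^+ 2 + \sum_(j < m) (c j.+1 - c j) ^+ 2 + c m ^+ 2
  - mu * \sum_(j < m.+1) c j ^+ 2.
Proof.
elim: m => [|m ih] Bpos.
  rewrite signedA0 signedA1 big_ord0 big_ord1 divr1 addr0.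
  rewrite le_eqVlt; apply/orP; left; apply/eqP; field.
  by lra.
have {ih} := ih (fun j jm => Bpos j (leqW jm)).
rewrite [\sum_(j < m.+1) (c j.+1 - c j) ^+ 2]big_ord_recr.
rewrite [\sum_(j < m.+2) _]big_ord_recr /= signedASS.
have := Bpos m (leqnSn m); have := Bpos m.+1 (leqnn _).
set b := B m.+1 mu; set a := B m mu => b0 a0 h.
(* Pivot recursion: with d = b/a, the next pivot is 2 - mu - 1/d. *)
have -> : ((2 - mu) * b - a) / b = 2 - mu - a / b.
  by field; lra.
(* The square that eliminates c_m, discarded in the estimate. *)
have sq : 0 <= b / a * (c m - a / b * c m.+1) ^+ 2.
  by rewrite mulr_ge0 ?sqr_ge0 ?divr_ge0 ?ltW.
have sqE : b / a * (c m - a / b * c m.+1) ^+ 2 =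
   b / a * c m ^+ 2 - 2 * c m * c m.+1 + a / b * c m.+1 ^+ 2.
  by field; lra.
move: h sq; rewrite sqE.
set s1 := \sum_(_ < _) _; set s2 := \sum_(_ < _) _.
set u := M / _ * _; nra.
Qed.

End sturm.

Theorem theorem2p9 (R : realType) (M : R) (hM : 0 <= M) (n : nat)
    (hn : (1 <= n)%N) :
  exists mu : R, smallest_zero (A M n) mu /\
    forall p : {poly R}, (size p <= n.+1)%N ->
      c1 (p^`() ^+ 2) <= 1 / mu * c0 M (p ^+ 2).
Proof.
case: n hn => // n _.
have [mu [mu_min mu_gt0 Bpos]] := exists_smallest_zeroA hM n.
exists mu; split=> // p sp.
rewrite mul1r mulrC ler_pdivlMr// mulrC /c0.
have parseval := laguerre_parseval (@c1D R) (@c1Z R) (@c1_by_parts R).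
have [c cn dp] := laguerre_span (size_deriv_leq sp).
have -> : c1 (p^`() ^+ 2) = \sum_(j < n.+1) c j ^+ 2 by rewrite dp parseval.
have -> : c1 (p ^+ 2) =
    (p.[0] + c 0%N) ^+ 2 + \sum_(j < n.+1) (c j.+1 - c j) ^+ 2.
  rewrite {1}(laguerre_antiderivative cn dp).
  pose d j := if j is i.+1 then c i.+1 - c i else p.[0] + c 0%N.
  by have := parseval n.+2 d; rewrite !(big_ord_recl n.+1).
have := jacobi_form_ge hM c (fun j jn => Bpos j mu jn (lexx mu)).
(* The last pivot vanishes at [mu], so the form minus mu times the sum of squares is nonnegative. *)
have /eqP -> : signedA M n.+1 mu == 0.
  by rewrite -root_signedA; case: mu_min.
(* As c_{n+1} = 0, the last difference supplies the c_n^2 of the Jacobi form. *)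
rewrite !mul0r [\sum_(j < n.+1) (c j.+1 - c j) ^+ 2]big_ord_recr /=.
rewrite cn sub0r sqrrN horner_exp.
set s := \sum_(_ < n) _; set s2 := \sum_(_ < _) _.
(* The minimum over [t = p.[0]] of [(t + c 0)^2 + M t^2]. *)
have : M / (1 + M) * c 0%N ^+ 2 <= (p.[0] + c 0%N) ^+ 2 + M * p.[0] ^+ 2.
  have -> : (p.[0] + c 0%N) ^+ 2 + M * p.[0] ^+ 2 =
     M / (1 + M) * c 0%N ^+ 2 + (1 + M) * (p.[0] + c 0%N / (1 + M)) ^+ 2.
    by field; lra.
  by rewrite lerDl mulr_ge0 ?sqr_ge0//; lra.
by lra.
Qed.
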